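(* Let $k\ge 1$ be an integer and let $\mathcal{H}\subseteq FIN_k^{[\infty]}$ be a semiselective Gowers coideal of block sequences. Then every analytic subset of $FIN_k^{[\infty]}$ (with respect to the metric topology on $FIN_k^{[\infty]}$) is $\mathcal{H}$-Ramsey.
   Context: Block sequences. Let $\mathbb{N}=\{0,1,2,\dots\}$ and fix an integer $k\ge 1$. $FIN_k$ is the set of functions $p:\mathbb{N}\to\{0,1,\dots,k\}$ whose support $supp(p)=\{n: p(n)\ne 0\}$ is finite and whose image contains $k$. A block sequence is a finite (possibly empty) or infinite (indexed in order type $\mathbb{N}$) sequence of elements of $FIN_k$ such that $\max(supp(x))<\min(supp(y))$ whenever $x$ precedes $y$; it is identified with its set of terms. $FIN_k^{[\infty]}$, $FIN_k^{[<\infty]}$ and $FIN_k^{[n]}$ are the sets of infinite, finite, and length-$n$ block sequences; $|a|$ is the length of $a$. For $j\in\mathbb{N}$ put $T^{(j)}(p)(n)=\max\{p(n)-j,0\}$. For a finite or infinite block sequence $A=(a_n)_{n\in I}$, $[A]\subseteq FIN_k$ is the set of all functions $T^{(j_0)}(a_{n_0})+\cdots+T^{(j_r)}(a_{n_r})$ with $n_0<\cdots<n_r$ in $I$, $j_0,\dots,j_r\in\{0,1,\dots,k\}$ and $j_i=0$ for at least one $i$. $A\le B$ means $A\subseteq[B]$. $A\upharpoonright n$ is the sequence of the first $n$ terms of $A$ ($A\upharpoonright 0=\emptyset$), and $a\sqsubset B$ means $a=B\upharpoonright n$ for some $n$. For a finite block sequence $a$, $supp(a)$ is the union of the supports of its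 terms; $a<b$ means $\max(supp(a))<\min(supp(b))$ (always true if $a=\emptyset$). $A/a=\{b\in A: a<b\}$. For $a\in FIN_k^{[<\infty]}$ and $A\in FIN_k^{[\infty]}$, $[a,A]=\{B\in FIN_k^{[\infty]}: a\sqsubset B \text{ and } B/a\subseteq[A]\}$; in particular $[\emptyset,A]=\{B\in FIN_k^{[\infty]}: B\le A\}$. The metric topology on $FIN_k^{[\infty]}$ is the subspace topology inherited from $FIN_k^{\mathbb{N}}$ with the product topology, $FIN_k$ being discrete; its basic open sets are $\{A\in FIN_k^{[\infty]}: b\sqsubset A\}$ for $b\in FIN_k^{[<\infty]}$. Coideals. $\mathcal{H}\subseteq FIN_k^{[\infty]}$ is a coideal of block sequences if (i) $A\le B$ and $A\in\mathcal{H}$ (with $A,B\in FIN_k^{[\infty]}$) imply $B\in\mathcal{H}$; and (ii) for every $A\in\mathcal{H}$ and every partition $A=B\cup C$ there is $D\in\mathcal{H}$ with $D\le B$ or $D\le C$. Write $\mathcal{H}\upharpoonright A=\{B\in\mathcal{H}: B\le A\}$. $\mathcal{H}$ is Gowers if for every integer $r>0$, every $A\in\mathcal{H}$ and every $f:FIN_k\to\{0,\dots,r-1\}$ there is $B\in\mathcal{H}\upharpoonright A$ such that $f$ is constant on $[B]$. A set $\mathcal{D}\subseteq\mathcal{H}$ is dense open in $(\mathcal{H},\le)$ if $B\in\mathcal{D}$, $A\in\mathcal{H}$, $A\le B$ imply $A\in\mathcal{D}$, and for every $A\in\mathcal{H}$ there is $B\in\mathcal{D}$ with $B\le A$. If $(A_n)_{n\in\mathbb{N}}$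 is a $\le$-decreasing sequence in $FIN_k^{[\infty]}$, then $B\in FIN_k^{[\infty]}$ is a diagonalization of $(A_n)_n$ if $B/b\le A_n$ for every $b\in[B]$, where $n=\max(supp(b))$. $\mathcal{H}$ is semiselective if for every $A\in\mathcal{H}$ and every sequence $(\mathcal{D}_n)_{n\in\mathbb{N}}$ of dense open subsets of $(\mathcal{H},\le)$ there are a $\le$-decreasing sequence $(A_n)_n$ with $A_n\in\mathcal{D}_n$ for all $n$ and some $B\in\mathcal{H}\upharpoonright A$ which is a diagonalization of $(A_n)_n$. $\mathcal{X}\subseteq FIN_k^{[\infty]}$ is $\mathcal{H}$-Ramsey if for all $A\in\mathcal{H}$ and $a\in FIN_k^{[<\infty]}$ there is $B\in[a,A]\cap\mathcal{H}$ with $[a,B]\subseteq\mathcal{X}$ or $[a,B]\cap\mathcal{X}=\emptyset$. *)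

(* Defs.v *)
From HB Require Import structures.
From mathcomp Require Import all_boot all_order finmap.
From mathcomp Require Import all_classical topology.

Set Implicit Arguments.
Unset Strict Implicit.
Unset Printing Implicit Defensive.

Local Open Scope nat_scope.
Local Open Scope classical_set_scope.

Definition FIN_set (k : nat) : set {fsfun nat -> 'I_k.+1 with ord0} :=
  [set p : {fsfun nat -> 'I_k.+1 with ord0} | exists n, p n = k :> nat].
Arguments FIN_set : clear implicits.

Definition FIN (k : nat) : Type := set_type (FIN_set k).
HB.instance Definition _ k := Choice.on (FIN k).

Definition FIN_fun k (p : FIN k) : nat -> nat := fun n => val p n.
Coercion FIN_fun : FIN >-> Funclass.

Definition supp k (p : FIN k) : {fset nat} := finsupp (val p).

Definition max_supp k (p : FIN k) : nat := \max_(n <- supp p) n.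

(* max (supp p) < min (supp q): supports are nonempty when 0 < k. *)
Definition block_lt k : rel (FIN k) :=
  [rel p q | all (fun n => max_supp p < n) (supp q)].

Definition tetris (j : nat) (p : nat -> nat) : nat -> nat := fun n => p n - j.

Definition fin_block k (a : seq (FIN k)) : Prop := pairwise (@block_lt k) a.

(* Infinite block sequences, with the subspace topology inherited from the
   countable power of the discrete space FIN k. *)
Definition block_set (k : nat) :
    set (prod_topology (fun _ : nat => discrete_topology (FIN k))) :=
  [set A | forall i j : nat, i < j -> block_lt (A i : FIN k) (A j : FIN k)].
Arguments block_set : clear implicits.

Definition blockseq (k : nat) : Type := set_type (block_set k).
HB.instance Definition _ k := Topological.on (blockseq k).

Definition term k (A : blockseq k) : nat -> FIN k := val A.

Definition terms k (A : blockseq k) : set (FIN k) := range (term A).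

(* [S], for a finite or infinite block sequence identified with its set S of
   terms.  The list s holds the pairs (a_{n_i}, j_i); since the terms of a block
   sequence are enumerated in block order, n_0 < ... < n_r becomes
   a_{n_0} < ... < a_{n_r}. *)
Definition span k (S : set (FIN k)) : set (FIN k) :=
  [set q | exists s : seq (FIN k * 'I_k.+1),
    [/\ forall u, u \in s -> S u.1,
        pairwise (fun u v => block_lt u.1 v.1) s,
        exists2 u, u \in s & u.2 = 0 :> nat &
        forall n, q n = \sum_(u <- s) tetris u.2 u.1 n]].

(* S <= B, for block sequences given by their sets of terms. *)
Definition set_le k (S B : set (FIN k)) : Prop := S `<=` span B.

Definition block_le k (A B : blockseq k) : Prop := set_le (terms A) (terms B).

(* A/a, as a set of terms *)
Definition tail k (A : blockseq k) (a : seq (FIN k)) : set (FIN k) :=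
  [set b | terms A b /\ forall x, x \in a -> block_lt x b].

Definition initial_segment k (a : seq (FIN k)) (B : blockseq k) : Prop :=
  exists n, a = mkseq (term B) n.

(* [a, A]; tail B a stands for B/a *)
Definition ellentuck k (a : seq (FIN k)) (A : blockseq k) : set (blockseq k) :=
  [set B | initial_segment a B /\ set_le (tail B a) (terms A)].

(* The parts of a partition of a block sequence are (finite or infinite) block
   sequences, given here by their sets of terms. *)
Definition coideal k (H : set (blockseq k)) : Prop :=
  (forall A B, block_le A B -> H A -> H B) /\
  (forall A, H A -> forall B C : set (FIN k),
     terms A = B `|` C -> B `&` C = set0 ->
     exists2 D, H D & set_le (terms D) B \/ set_le (terms D) C).

Definition restr k (H : set (blockseq k)) (A : blockseq k) :
    set (blockseq k) := [set B | H B /\ block_le B A].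

Definition gowers k (H : set (blockseq k)) : Prop :=
  forall r : nat, 0 < r ->
  forall (A : blockseq k) (f : FIN k -> 'I_r), H A ->
  exists2 B, restr H A B & exists c, forall p, span (terms B) p -> f p = c.

Definition dense_open k (H D : set (blockseq k)) : Prop :=
  [/\ D `<=` H,
      forall A B, D B -> H A -> block_le A B -> D A &
      forall A, H A -> exists2 B, D B & block_le B A].

Definition decreasing k (A_ : nat -> blockseq k) : Prop :=
  forall m n, m <= n -> block_le (A_ n) (A_ m).

Definition diagonalization k (B : blockseq k) (A_ : nat -> blockseq k) : Prop :=
  forall b, span (terms B) b ->
  set_le (tail B [:: b]) (terms (A_ (max_supp b))).

Definition semiselective k (H : set (blockseq k)) : Prop :=
  forall A, H A -> forall D_ : nat -> set (blockseq k),
  (forall n, dense_open H (D_ n)) ->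
  exists A_ : nat -> blockseq k,
    [/\ decreasing A_, forall n, D_ n (A_ n) &
        exists2 B, restr H A B & diagonalization B A_].

Definition ramsey k (H X : set (blockseq k)) : Prop :=
  forall (A : blockseq k) (a : seq (FIN k)), H A -> fin_block a ->
  exists B, [/\ ellentuck a A B, H B &
    ellentuck a B `<=` X \/ ellentuck a B `&` X = set0].

Definition baire_space := prod_topology (fun _ : nat => nat).

Definition analytic (T : topologicalType) (X : set T) : Prop :=
  X = set0 \/
  exists f : baire_space -> T, continuous f /\ range f = X.

(* Main.v *)
(* A combinatorial form of the Mathias and Prikry properties of the forcing with
   conditions (b, B), where B is in H and b is a finite block sequence.
   Semiselectivity gives a fusion lemma: countably many dense open requirements
   indexed by finite block sequences b can be met at once at all b in [B]; a
   requirement with code i need only be met when i <= |b|.  With one application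
   of the Gowers property per stem, fusion yields the Galvin-Nash-Williams theorem
   for open sets, and then its version for countable intersections of open sets.
   Now let X_s be the image of the basic open set N_s of the Baire space.  After a
   fusion deciding for all b and s whether some D in H has [b, D] disjoint from X_s,
   let K_s be the open set of those Y for which this happens at some long enough
   initial segment.  By the G_delta case, the set of Y outside K_s but in all K_(s i)
   is null, and a last fusion avoids all these null sets.  Every Y outside K_() then
   has a branch g with Y outside K_(g|n) for all n, so Y = f g by continuity: below
   the fused condition the analytic set is the complement of the open set K_().

   A stem b is removed by considering the tails Y with b ^ Y in the given set. *)
Require Import Defs.
From mathcomp Require Import finmap.
From mathcomp Require Import all_boot all_classical topology.

Set Implicit Arguments.
Unset Strict Implicit.
Unset Printing Implicit Defensive.

Local Open Scope nat_scope.
Local Open Scope classical_set_scope.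

(** * Continuous images of the Baire space *)

(** Convergence in a product is coordinatewise, and coordinate [i] of [h n] is constant for
    [n > i]. *)
Lemma baire_cvg (g : baire_space) (h : nat -> baire_space) :
  (forall n i, i < n -> h n i = g i) -> h @ \oo --> g.
Proof.
move=> hg; apply/cvg_sup => i U [_ [[W oW <-] Wg WU]].
by apply: (filterS WU); exists i.+1 => // n /= i_n; rewrite /proj hg.
Qed.

Lemma term_continuous k i :
  continuous (fun X : blockseq k => term X i : discrete_topology (FIN k)).
Proof.
move=> X; apply: (@continuous_comp _ _ _ (set_val : blockseq k -> _) (proj i)).
  exact: initial_continuous.
exact: proj_continuous.
Qed.

(** Counterexamples [h n] for every [n] would converge to [g], so their images converge to [f g]. As
    terms live in a discrete space, the first [m] of them would eventually be those of [f g]. *)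
Lemma continuous_baire k (f : baire_space -> blockseq k) g m : continuous f ->
  exists n, forall h : baire_space, (forall i, i < n -> h i = g i) ->
    mkseq (term (f h)) m = mkseq (term (f g)) m.
Proof.
move=> cf; apply: contrapT => nE.
have /choice[h hP] : forall n, exists h : baire_space,
    (forall i, i < n -> h i = g i) /\ mkseq (term (f h)) m <> mkseq (term (f g)) m.
  move=> n; apply: contrapT => nh; apply: nE; exists n => h hg.
  by apply: contrapT => hm; apply: nh; exists h.
have fh : f \o h @ \oo --> f g.
  by apply: continuous_cvg => //; [exact: cf|apply: baire_cvg => n; case: (hP n)].
have ev i : \forall n \near \oo, term (f (h n)) i = term (f g) i.
  have : (fun n => term (f (h n)) i : discrete_topology (FIN k)) @ \oo
      --> (term (f g) i : discrete_topology (FIN k)).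
    exact: (cvg_comp _ _ fh (@term_continuous k i (f g))).
  by move=> /(_ _ (@discrete_set1 (discrete_topology (FIN k)) (term (f g) i))).
have [N _ NP] : \forall n \near \oo, mkseq (term (f (h n))) m = mkseq (term (f g)) m.
  elim: {hP nE} m => [|m IH]; first by near=> n.
  by near=> n; rewrite !mkseqS; congr rcons; near: n.
by case: (hP N) => _; apply; apply: NP => /=.
Unshelve. all: by end_near. Qed.

(** * Block sequences *)

Section Blocks.
Context (k : nat) (hk : 0 < k).
Implicit Types (p q : FIN k) (A B C D X Y : blockseq k) (a b : seq (FIN k)).
Implicit Types S : set (FIN k).

Lemma suppE p n : (n \in supp p) = (p n != 0).
Proof. by rewrite /supp mem_finsupp. Qed.

Lemma FIN_top p : exists n, p n = k.
Proof. exact: set_mem (valP p). Qed.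

Lemma FIN_ext p q : p =1 q -> p = q.
Proof. by move=> pq; apply/val_inj/fsfunP => n; apply/val_inj/pq. Qed.

Lemma leq_max_supp p n : p n != 0 -> n <= max_supp p.
Proof. by rewrite -suppE => pn; exact: leq_bigmax_seq. Qed.

Lemma block_ltP p q :
  reflect (forall m n, p m != 0 -> q n != 0 -> m < n) (block_lt p q).
Proof.
apply: (iffP allP) => [pq m n pm qn|pq n].
  by apply: leq_ltn_trans (leq_max_supp pm) (pq n _); rewrite suppE.
(* The point [m] of the support of [p] yields [0 < n], which handles the starting value 0 of the
   maximum. *)
rewrite suppE => qn; have [m pm] := FIN_top p.
have m_n : m < n by apply: pq => //; rewrite pm -lt0n.
rewrite /max_supp big_seq; elim/big_ind: _ => [|i j ni nj|i].
- exact: leq_ltn_trans m_n.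
- by rewrite gtn_max ni.
- by rewrite suppE => /pq; apply.
Qed.

Lemma block_lt_trans : transitive (@block_lt k).
Proof.
move=> q p r /block_ltP pq /block_ltP qr; apply/block_ltP => m n pm rn.
have [i qi] := FIN_top q; have qi0 : q i != 0 by rewrite qi -lt0n.
exact: ltn_trans (pq _ _ pm qi0) (qr _ _ qi0 rn).
Qed.

Lemma block_ltxx p : block_lt p p = false.
Proof.
apply/block_ltP => pp; have [i pi] := FIN_top p.
by have := pp i i; rewrite ltnn pi -lt0n hk => /(_ isT isT).
Qed.

Lemma term_lt A i j : i < j -> block_lt (term A i) (term A j).
Proof. exact: set_mem (valP A) i j. Qed.

Lemma term_block_ltE A i j : block_lt (term A i) (term A j) = (i < j).
Proof.
case: (ltngtP i j) => [/(term_lt A)//|ji|->]; last exact: block_ltxx.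
apply/negP => ij; have := block_lt_trans (term_lt A ji) ij.
by rewrite block_ltxx.
Qed.

Lemma term_inj A : injective (term A).
Proof.
move=> i j eq_ij; case: (ltngtP i j) => // /(term_lt A);
by rewrite eq_ij block_ltxx.
Qed.

Lemma blockseq_of (u : nat -> FIN k) :
  (forall i j, i < j -> block_lt (u i) (u j)) ->
  exists A, term A = u.
Proof. by move=> uP; exists (exist _ u (mem_set uP)). Qed.

Lemma shift_exists A m : exists B, forall i, term B i = term A (m + i).
Proof.
have [i j ij|B BE] := @blockseq_of (fun i => term A (m + i)).
  by apply: term_lt; rewrite ltn_add2l.
by exists B => i; rewrite BE.
Qed.

(** Supports are nonempty and successive, so their minima increase strictly. *)
Lemma leq_term_supp A i n : term A i n != 0 -> i <= n.
Proof.
elim: i n => // i IH n An; have [m Am] := FIN_top (term A i).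
have Am0 : term A i m != 0 by rewrite Am -lt0n.
exact: leq_ltn_trans (IH _ Am0) (block_ltP _ _ (term_lt A (ltnSn i)) _ _ Am0 An).
Qed.

(* Without the vanishing summands T^(k)(a_n), which [span] allows, the
   representation reflects the block order. *)
Definition rep S q (s : seq (FIN k * 'I_k.+1)) : Prop :=
  [/\ forall u, u \in s -> S u.1 /\ u.2 < k,
      pairwise (fun u v => block_lt u.1 v.1) s,
      exists2 u, u \in s & u.2 = 0 :> nat &
      forall n, q n = \sum_(u <- s) tetris u.2 u.1 n].

Lemma FIN_leq p n : p n <= k.
Proof. by rewrite -ltnS; exact: ltn_ord. Qed.

Lemma span_rep S q : span S q -> exists s, rep S q s.
Proof.
case=> s [sS sp [u us u0] sE].
exists [seq v : FIN k * 'I_k.+1 <- s | v.2 < k]; split.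
- by move=> v; rewrite mem_filter => /andP[vk /sS].
- exact: pairwise_filter.
- by exists u => //; rewrite mem_filter us u0 hk.
- move=> n; rewrite sE big_filter (bigID (fun v : _ * 'I_k.+1 => v.2 < k)) /=.
  rewrite [X in _ + X]big1 ?addn0 // => v; rewrite -leqNgt => kv.
  by apply/eqP; rewrite subn_eq0 (leq_trans (FIN_leq _ _)).
Qed.

Lemma rep_supp S q s n : rep S q s ->
  q n != 0 -> exists2 u : FIN k * 'I_k.+1, u \in s & u.1 n != 0.
Proof.
case=> _ _ _ ->; rewrite sum_nat_seq_neq0 => /hasP[u us] /= un.
by exists u => //; apply: contra_neq un; rewrite /tetris => ->.
Qed.

(** A shift below [k] leaves a summand positive where its term takes the value [k]. *)
Lemma rep_top S q s (u : FIN k * 'I_k.+1) n :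
  rep S q s -> u \in s -> u.1 n = k -> q n != 0.
Proof.
case=> sS _ _ -> us un; rewrite sum_nat_seq_neq0; apply/hasP; exists u => //=.
by rewrite /tetris un -lt0n subn_gt0; case: (sS u us).
Qed.

(* Places where a used term takes the value k stay in the support. *)
Lemma span_rep_lt B p q s t (u v : FIN k * 'I_k.+1) :
    rep (terms B) p s -> rep (terms B) q t -> block_lt p q ->
  u \in s -> v \in t -> block_lt u.1 v.1.
Proof.
move=> ps qt /block_ltP pq us vt.
have [[/= i _ iu] _] : terms B u.1 /\ u.2 < k by case: ps => + _ _ _; apply.
have [[/= j _ jv] _] : terms B v.1 /\ v.2 < k by case: qt => + _ _ _; apply.
have [m um] := FIN_top u.1; have [n vn] := FIN_top v.1.
have mn := pq _ _ (rep_top ps us um) (rep_top qt vt vn).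
rewrite -iu -jv term_block_ltE ltnNge; apply/negP => ji.
case: (ltngtP i j) ji => // [ji|eq_ij] _.
  have := block_ltP _ _ (term_lt B ji) n m.
  by rewrite iu jv um vn -lt0n hk => /(_ isT isT) /(ltn_trans mn); rewrite ltnn.
have := pq m m (rep_top ps us um); rewrite ltnn => F; apply/notF/F.
by apply: (rep_top qt vt); rewrite -jv -eq_ij iu.
Qed.

Lemma span_tail B p q : span (terms B) p -> span (terms B) q -> block_lt p q ->
  span (tail B [:: p]) q.
Proof.
move=> /span_rep[s ps] /span_rep[t qt] pq; have [tS tp t0 tE] := qt.
exists t; split=> // v vt; split=> [|x]; first by case: (tS v vt).
rewrite inE => /eqP ->; apply/block_ltP => m n.
move=> /(rep_supp ps)[u us um] vn.
exact: (block_ltP _ _ (span_rep_lt ps qt pq us vt)) um vn.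
Qed.

Lemma sub_span S : S `<=` span S.
Proof.
move=> p Sp; exists [:: (p, ord0)]; split=> //.
- by move=> u; rewrite inE => /eqP ->.
- by exists (p, ord0); rewrite ?inE.
- by move=> n; rewrite big_seq1 /tetris subn0.
Qed.

(** Supports are disjoint, so at each point at most one summand is nonzero and truncated subtraction
    passes through the sum. *)
Lemma sum_tetris (s : seq (FIN k * 'I_k.+1)) (m n : nat) :
    pairwise (fun u v => block_lt u.1 v.1) s ->
  \sum_(u <- s) tetris u.2 u.1 n - m = \sum_(u <- s) (tetris u.2 u.1 n - m).
Proof.
elim: s => [|u s IH] /=; first by rewrite !big_nil.
case/andP=> us sp; rewrite !big_cons -IH //.
have [u0|un] := eqVneq (u.1 n) 0; first by rewrite /tetris u0.
rewrite (_ : \sum_(_ <- _) _ = 0) ?addn0 ?sub0n ?addn0 //.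
rewrite big_seq big1 // => v vs; apply/eqP; rewrite subn_eq0.
apply: leq_trans (leq0n _); rewrite leqn0; apply/negPn/negP => vn.
by have := block_ltP _ _ (allP us v vs) n n un vn; rewrite ltnn.
Qed.

Lemma span_trans S B : S `<=` span (terms B) -> span S `<=` span (terms B).
Proof.
move=> SB q /span_rep[t [tS tp [u0 u0t u00] tE]].
have /choice[f fP] : forall u : FIN k * 'I_k.+1,
    exists s, u \in t -> rep (terms B) u.1 s.
  move=> u; have [ut|_] := boolP (u \in t); last by exists [::].
  by have [s us] := span_rep (SB _ (proj1 (tS u ut))); exists s.
(* Composing two shifts adds them. The cap at [k] keeps the sum in ['I_k.+1] and is harmless, since
   values never exceed [k]. *)
pose g (u : FIN k * 'I_k.+1) : seq (FIN k * 'I_k.+1) :=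
  [seq (v.1, inord (minn (v.2 + u.2) k)) | v : FIN k * 'I_k.+1 <- f u].
have g1 (u w : FIN k * 'I_k.+1) : w \in g u ->
    exists2 v : FIN k * 'I_k.+1, v \in f u & w.1 = v.1.
  by case/mapP=> v vf ->; exists v.
have gE (u v : FIN k * 'I_k.+1) : tetris (inord (minn (v.2 + u.2) k) : 'I_k.+1) v.1 =1
    (fun n => tetris v.2 v.1 n - u.2) :> (nat -> nat).
  move=> n; rewrite /tetris inordK ?ltnS ?geq_minr // -subnDA.
  have e x : k <= x -> v.1 n - x = 0.
    by move=> kx; apply/eqP; rewrite subn_eq0 (leq_trans (FIN_leq _ _)).
  have [le_k|/ltnW lt_k] := leqP (v.2 + u.2) k => //.
  by rewrite !e.
exists (flatten [seq g u | u <- t]); split.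
- move=> w /flatten_mapP[u ut /g1[v vf ->]].
  by case: (fP u ut) => + _ _ _ => /(_ v vf)[].
- suff pw r : pairwise (fun u v => block_lt u.1 v.1) r -> {subset r <= t} ->
      pairwise (fun u v => block_lt u.1 v.1) (flatten [seq g u | u <- r]).
    exact: pw.
  elim: r => //= u r IH /andP[ur rp] rt.
  rewrite pairwise_cat IH ?andbT //; last first.
    by move=> v vr; apply: rt; rewrite inE vr orbT.
  have ut : u \in t by apply: rt; rewrite mem_head.
  apply/andP; split.
    apply/allrelP => w w' /g1[v vf ->] /flatten_mapP[u' u'r /g1[v' v'f ->]].
    have u't : u' \in t by apply: rt; rewrite inE u'r orbT.
    exact: (span_rep_lt (fP _ ut) (fP _ u't) (allP ur _ u'r)).
  by rewrite pairwise_map; case: (fP u ut).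
- have [_ _ [v vf v0] _] := fP _ u0t.
  exists (v.1, inord (minn (v.2 + u0.2) k)).
    by apply/flatten_mapP; exists u0 => //; apply/mapP; exists v.
  by rewrite /= v0 u00 min0n inordK.
- move=> n; rewrite tE big_flatten big_map big_seq [RHS]big_seq.
  apply: eq_bigr => u ut; have [_ fp _ fE] := fP u ut.
  by rewrite [LHS](congr1 (subn^~ u.2) (fE n)) sum_tetris // big_map;
  apply: eq_bigr => v _; rewrite gE.
Qed.

Lemma block_le_refl A : block_le A A.
Proof. exact: sub_span. Qed.

Lemma block_le_trans B A C : block_le A B -> block_le B C -> block_le A C.
Proof. by move=> AB BC p /AB; apply: span_trans. Qed.

Lemma block_le_span A B p : block_le A B -> span (terms A) p -> span (terms B) p.
Proof. by move=> AB; apply: span_trans. Qed.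

Lemma term_span A i : span (terms A) (term A i).
Proof. by apply: sub_span; exists i. Qed.

Lemma tail_start B p : exists m, forall i, block_lt p (term B i) = (m <= i).
Proof.
have ex : exists m, block_lt p (term B m).
  exists (max_supp p).+1; apply/block_ltP => i j /leq_max_supp pi /leq_term_supp.
  exact: leq_trans.
exists (ex_minn ex); case: ex_minnP => m pm min i.
apply/idP/idP => [/min//|]; rewrite leq_eqVlt => /predU1P[<-//|mi].
exact: block_lt_trans (term_lt B mi).
Qed.

(** * Finiteness of the stems with bounded support *)

Lemma fin_block_uniq a : fin_block a -> uniq a.
Proof. by apply: pairwise_uniq => p; exact: block_ltxx. Qed.

Lemma block_lt_max p q : block_lt p q -> max_supp p < max_supp q.
Proof.
move=> pq; have [n qn] := FIN_top q; have qn0 : q n != 0 by rewrite qn -lt0n.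
apply: leq_trans (leq_max_supp qn0).
by apply: (allP pq); rewrite suppE.
Qed.

(** Maxima of supports increase strictly. In the fusion this bounds the length of a stem in terms of
    the index [max_supp] at which a diagonalization treats it. *)
Lemma size_fin_block b p : fin_block (rcons b p) -> size b <= max_supp p.
Proof.
elim/last_ind: b p => // b q IH p.
rewrite /fin_block pairwise_rcons size_rcons => /andP[/allP bp bq].
by apply: leq_ltn_trans (IH _ bq) (block_lt_max (bp q _)); rewrite mem_rcons mem_head.
Qed.

Lemma finite_FIN n : finite_set [set p : FIN k | max_supp p <= n].
Proof.
pose f (p : FIN k) :=
  if max_supp p <= n then Some [ffun i : 'I_n.+1 => val p i] else None.
have -> : [set p : FIN k | max_supp p <= n] = f @^-1` [set x | x].
  by rewrite eqEsubset /f; split=> p /=; case: ifP.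
apply: finite_preimage; last exact: finite_finset.
move=> p q; rewrite !inE /f /=; case: ifP => // pn _; case: ifP => // qn _.
case=> /ffunP pq; apply: FIN_ext => i.
have [i_n|n_i] := leqP i n.
  by have := pq (Ordinal (i_n : i < n.+1)); rewrite !ffunE => /(congr1 val).
have out (r : FIN k) : max_supp r <= n -> r i = 0.
  move=> rn; apply/eqP/negPn/negP => /leq_max_supp ri.
    by move: n_i; rewrite ltnNge (leq_trans ri).
by rewrite !out.
Qed.

(** Terms are not repeated, so the length is at most the number of available terms. Hence each stage
    of a fusion meets finitely many stems. *)
Lemma finite_fin_block n : exists L : seq (seq (FIN k)),
  forall b, fin_block b -> (forall p, p \in b -> max_supp p <= n) -> b \in L.
Proof.
have [P PE] := (finite_seqP _).1 (finite_FIN n).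
have mem_P p : max_supp p <= n -> p \in P.
  by move=> pn; have : [set p : FIN k | max_supp p <= n] p by []; rewrite PE.
suff [L Lb] : exists L : seq (seq (FIN k)),
    forall b, {subset b <= P} -> size b <= size P -> b \in L.
  exists L => b bb bn; have bP : {subset b <= P} by move=> p /bn /mem_P.
  by apply: Lb => //; apply: uniq_leq_size => //; exact: fin_block_uniq.
elim: (size P) => [|m [L Lb]]; first by exists [:: [::]] => -[].
exists ([::] :: [seq p :: b | p <- P, b <- L]) => -[|p b] pbP bm; first exact: mem_head.
rewrite inE; apply/orP; right; apply/allpairsP; exists (p, b); split=> //=.
  by apply: pbP; exact: mem_head.
by apply: Lb => // q qb; apply: pbP; rewrite inE qb orbT.
Qed.

(** * Cylinders and concatenation *)

(** The set [b, B] written with indices: once [b] is an initial segment of [X], the terms beyond [b]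
    are those of index at least [size b]. *)
Definition cyl b B : set (blockseq k) :=
  [set X | mkseq (term X) (size b) = b /\
           forall i, size b <= i -> span (terms B) (term X i)].

Lemma cylS b B C : block_le C B -> cyl b C `<=` cyl b B.
Proof. by move=> CB X [Xb XC]; split=> // i /XC; apply: block_le_span. Qed.

Lemma cyl_nil B X : cyl [::] B X <-> block_le X B.
Proof.
split=> [[_ XB] _ [i _ <-]|XB]; first exact: XB.
by split=> // i _; apply: XB; exists i.
Qed.

Lemma cyl_mkseq b B X n : cyl b B X -> size b <= n ->
  cyl (mkseq (term X) n) B X /\ cyl (mkseq (term X) n) B `<=` cyl b B.
Proof.
move=> [Xb XB] bn; split.
  by split; rewrite size_mkseq // => i ni; apply/XB/(leq_trans bn).
move=> Y []; rewrite size_mkseq => YX YB; split.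
  have := congr1 (take (size b)) YX.
  by rewrite -!map_take !take_iota !(minn_idPl bn) -Xb size_mkseq.
move=> i bi; have [/YB//|iN] := leqP n i.
have := congr1 (fun s => nth (term X 0) s i) YX.
by rewrite !nth_mkseq // => ->; apply: XB.
Qed.

Lemma fin_block_mkseq A n : fin_block (mkseq (term A) n).
Proof.
apply/(pairwiseP (term A 0)) => i j; rewrite !inE size_mkseq => im jm ij.
by rewrite !nth_mkseq // term_lt.
Qed.

Lemma mkseq_le m n X Y : m <= n -> mkseq (term X) n = mkseq (term Y) n ->
  mkseq (term X) m = mkseq (term Y) m.
Proof.
move=> mn XY; have := congr1 (take m) XY.
by rewrite -!map_take !take_iota !(minn_idPl mn).
Qed.

Lemma blockseq_ext X Y : term X =1 term Y -> X = Y.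
Proof. by move=> XY; apply/val_inj/funext. Qed.

(** Concatenation is a relation, because [b] followed by [Y] is a block sequence only if [b] is one
    and lies before [Y]. *)
Definition is_cat b Y X : Prop :=
  mkseq (term X) (size b) = b /\ forall i, term X (size b + i) = term Y i.

Lemma is_cat_exists b Y : fin_block b -> (forall p, p \in b -> block_lt p (term Y 0)) ->
  exists X, is_cat b Y X.
Proof.
move=> bb bY; pose x0 := term Y 0.
pose u i := if i < size b then nth x0 b i else term Y (i - size b).
have [i j ij|X XE] := @blockseq_of u.
  rewrite /u; case: ltnP => ib; case: ltnP => jb.
  - exact: (pairwiseP x0 bb).
  - have bi := bY _ (mem_nth x0 ib).
    have [->//|jb0] := posnP (j - size b).
    exact: block_lt_trans bi (term_lt Y jb0).
  - by have := leq_ltn_trans ib (ltn_trans ij jb); rewrite ltnn.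
  - by apply: term_lt; rewrite ltn_sub2r // (leq_ltn_trans ib).
exists X; split=> [|i]; last by rewrite XE /u ltnNge leq_addr addKn.
apply: (@eq_from_nth _ x0); rewrite size_mkseq // => i ib.
by rewrite nth_mkseq // XE /u ib.
Qed.

Lemma is_cat_inj b Y X X' : is_cat b Y X -> is_cat b Y X' -> X = X'.
Proof.
move=> [Xb XY] [Xb' XY']; apply: blockseq_ext => i.
have [bi|ib] := leqP (size b) i; first by rewrite -(subnKC bi) XY XY'.
have := congr1 (fun s => nth (term X 0) s i) (etrans Xb (esym Xb')).
by rewrite /= !nth_mkseq.
Qed.

Lemma cyl_is_cat b B X : cyl b B X -> exists2 Y, is_cat b Y X & block_le Y B.
Proof.
move=> [Xb XB]; have [Y YX] := shift_exists X (size b).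
exists Y => [|_ [i _ <-]]; last by rewrite YX; apply: XB; rewrite leq_addr.
by split=> // i; rewrite YX.
Qed.

Lemma is_cat_mkseq b Y X n : is_cat b Y X ->
  mkseq (term X) (size b + n) = b ++ mkseq (term Y) n.
Proof.
move=> [Xb XY]; rewrite {1}/mkseq iotaD map_cat; congr (_ ++ _); first exact: Xb.
by rewrite add0n -[X in iota X n]addn0 iotaDl -map_comp; apply: eq_map.
Qed.

Lemma mkseq_is_cat b Y X :
  (forall m, mkseq (term X) (size b + m) = b ++ mkseq (term Y) m) -> is_cat b Y X.
Proof.
move=> XY; split=> [|i]; first by have := XY 0; rewrite addn0 cats0.
have := congr1 (fun s => nth (term X 0) s (size b + i)) (XY i.+1).
rewrite /= nth_mkseq ?ltn_add2l // nth_cat ltnNge leq_addr /= addKn.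
by rewrite nth_mkseq.
Qed.

Lemma span_block_lt S p q :
  (forall r, S r -> block_lt p r) -> span S q -> block_lt p q.
Proof.
move=> pS /span_rep[s qs]; apply/block_ltP => m n pm /(rep_supp qs)[u us un].
have [Su _] : S u.1 /\ u.2 < k by case: qs => + _ _ _; apply.
exact: (block_ltP _ _ (pS _ Su)).
Qed.

Lemma ellentuck_cyl b B : ellentuck b B `<=` cyl b B.
Proof.
move=> X [[n ->] XB]; split=> [|i]; rewrite size_mkseq // => ni.
apply: XB; split; first by exists i.
move=> _ /mapP[j + ->]; rewrite mem_iota => /andP[_ jn].
by apply: term_lt; apply: leq_trans ni.
Qed.

Lemma is_cat_mem b Y X i : is_cat b Y X -> i < size b -> term X i \in b.
Proof. by case=> Xb _ ib; rewrite -Xb map_f // mem_iota. Qed.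

Lemma is_cat_lt b Y X p i : is_cat b Y X -> p \in b -> size b <= i ->
  block_lt p (term X i).
Proof.
case=> Xb _; rewrite -{1}Xb => /mapP[j + ->] bi; rewrite mem_iota => /andP[_ jb].
by apply: term_lt; apply: leq_trans bi.
Qed.

(* A term of [X] lying beyond [b] cannot involve the terms of [b], whose
   maxima would survive in its support. *)
Lemma cyl_cat_sub b B C : is_cat b B C -> cyl b C `<=` cyl b B.
Proof.
move=> BC X [Xb XC]; split=> // i bi.
have [t Xt] := span_rep (XC i bi); have [tC tp t0 tE] := Xt.
exists t; split=> // -[u l] ut; have [[j _ /= ju] _] := tC _ ut.
have [jb|bj] := ltnP j (size b); last first.
  by exists (j - size b) => //; rewrite -ju -BC.2 subnKC.
have [m um] := FIN_top u; have um0 : (u : FIN k) m != 0 by rewrite um -lt0n.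
have [Y XY _] := cyl_is_cat (conj Xb XC : cyl b C X).
have ub : u \in b by rewrite -ju; exact: is_cat_mem BC jb.
have := block_ltP _ _ (is_cat_lt XY ub bi) m m um0 (rep_top Xt ut um).
by rewrite ltnn.
Qed.

(* Open for the metric topology. *)
Definition mopen (U : set (blockseq k)) : Prop := forall X, U X ->
  exists n, forall Y, mkseq (term Y) n = mkseq (term X) n -> U Y.

Definition fiber b (U : set (blockseq k)) : set (blockseq k) :=
  [set Y | forall X, is_cat b Y X -> U X].

Lemma mopen_fiber b U : fin_block b -> mopen U -> mopen (fiber b U).
Proof.
move=> bb oU Y UY; have [[X YX]|nX] := pselect (exists X, is_cat b Y X); last first.
  (* Whether [b] can be continued by [Y] depends on the first term of [Y] only, so sequences sharing
     that term are vacuously in the fiber. *)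
  exists 1 => Y' [Y0] X' YX'; case: nX; apply: is_cat_exists => // p.
  rewrite -Y0; case: YX' => Xb XY; rewrite -{1}Xb => /mapP[i]; rewrite mem_iota.
  by rewrite add0n => /andP[_ ib] ->; rewrite -XY; apply: term_lt; rewrite addn0.
have [n nU] := oU _ (UY X YX); exists n => Y' YY' X' YX'; apply: nU.
apply: mkseq_le (leq_addl (size b) n) _.
by rewrite !(is_cat_mkseq _ YX, is_cat_mkseq _ YX') YY'.
Qed.

Lemma fiber_sub b B U : (forall Y, block_le Y B -> fiber b U Y) -> cyl b B `<=` U.
Proof. by move=> BU X /cyl_is_cat[Y YX /BU]; apply. Qed.

Lemma fiber_disj b B U : (forall Y, block_le Y B -> ~ fiber b U Y) ->
  forall X, cyl b B X -> ~ U X.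
Proof.
move=> BU X /cyl_is_cat[Y YX /BU nY] UX; apply: nY => X' YX'.
by rewrite (is_cat_inj YX' YX).
Qed.

Definition in_span b B : Prop := forall p, p \in b -> span (terms B) p.

Lemma in_span_mkseq X B n : block_le X B -> in_span (mkseq (term X) n) B.
Proof. by move=> XB p /mapP[i _ ->]; apply: XB; exists i. Qed.

Lemma cyl_mkseq0 X B n : block_le X B -> cyl (mkseq (term X) n) B X.
Proof. by move=> XB; apply: (cyl_mkseq (proj2 (cyl_nil B X) XB) (leq0n n)).1. Qed.

Lemma mkseq_cyl X B Y n : cyl (mkseq (term X) n) B Y ->
  mkseq (term Y) n = mkseq (term X) n.
Proof. by case; rewrite size_mkseq. Qed.

Lemma cyl_le X B D Z n : block_le X B -> block_le D B ->
  cyl (mkseq (term X) n) D Z -> block_le Z B.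
Proof.
move=> XB DB DZ _ [i _ <-]; have [ni|i_n] := leqP n i.
  by apply: block_le_span DB _; apply: DZ.2; rewrite size_mkseq.
have := congr1 (fun s => nth (term X 0) s i) (mkseq_cyl DZ).
by rewrite !nth_mkseq // => ->; apply: XB; exists i.
Qed.

(** * Forcing with the coideal *)

Section Coideal.
Context (H : set (blockseq k)) (hc : coideal H).

Lemma coideal_le A B : block_le A B -> H A -> H B.
Proof. by case: hc => + _; apply. Qed.

(** Split [A] into its first [m] terms and the rest. No member of [H] lies below the finite part:
    supports in its span are bounded by [N], while term [N + 1] of [D] lives beyond [N]. *)
Lemma coideal_shift A B m :
  H A -> (forall i, term B i = term A (m + i)) -> H B.
Proof.
move=> HA BE.
have AE : terms A = [set term A i | i in `I_m] `|` terms B.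
  rewrite eqEsubset; split=> [_ [i _ <-]|_ [[i _ <-]|[i _ <-]]].
  - have [mi|im] := leqP m i; last by left; exists i.
    by right; exists (i - m) => //; rewrite BE subnKC.
  - by exists i.
  - by exists (m + i); rewrite ?BE.
have dAB : [set term A i | i in `I_m] `&` terms B = set0.
  rewrite -subset0 => _ [[i /= im <-] [j _]].
  by rewrite BE => /term_inj ij; move: im; rewrite -ij ltnNge leq_addr.
have [D HD [DA|]] := proj2 hc A HA _ _ AE dAB; last by move/coideal_le; apply.
pose N := \max_(i < m) max_supp (term A i).
have [n Dn] := FIN_top (term D N.+1).
have Dn0 : term D N.+1 n != 0 by rewrite Dn -lt0n.
have [s Ds] := span_rep (DA _ (ex_intro2 _ _ _ I (erefl (term D N.+1)))).
have [u us un] := rep_supp Ds Dn0.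
have [[/= i im iu] _] : [set term A i | i in `I_m] u.1 /\ u.2 < k.
  by case: Ds => + _ _ _; apply.
have : n <= N.
  apply: leq_trans (leq_max_supp un) _; rewrite -iu.
  exact: (leq_bigmax (Ordinal im)).
by rewrite leqNgt (leq_term_supp Dn0).
Qed.

Lemma coideal_tail A p : H A ->
  exists B, [/\ H B, terms B = tail A [:: p] & block_le B A].
Proof.
move=> HA; have [m mE] := tail_start A p; have [B BE] := shift_exists A m.
exists B; split; first exact: coideal_shift BE.
  rewrite eqEsubset; split=> [_ [i _ <-]|_ [[i _ <-] /(_ p)]].
    rewrite BE; split; first by exists (m + i).
    by move=> x; rewrite inE => /eqP ->; rewrite mE leq_addr.
  rewrite mem_head mE => /(_ isT) mi; exists (i - m) => //.
  by rewrite BE subnKC.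
by move=> _ [i _ <-]; rewrite BE; exact: term_span.
Qed.


(** Requirements that persist downwards can be met one after another; this serves a single stage of
    the fusion. *)
Lemma dense_seq (T : eqType) (L : seq T) (Q : T -> blockseq k -> Prop) A :
    (forall t C D, Q t C -> H D -> block_le D C -> Q t D) ->
    (forall t C, H C -> block_le C A -> exists D, [/\ H D, block_le D C & Q t D]) ->
  forall C, H C -> block_le C A ->
  exists D, [/\ H D, block_le D C & forall t, t \in L -> Q t D].
Proof.
move=> Qo Qd; elim: L => [|t L IH] C HC CA.
  by exists C; split=> //; exact: block_le_refl.
have [D [HD DC DQ]] := IH _ HC CA.
have [E [HE ED EQ]] := Qd t _ HD (block_le_trans DC CA).
exists E; split=> //; first exact: block_le_trans DC.
by move=> u; rewrite inE => /predU1P[->//|/DQ Qu]; apply: Qo Qu HE ED.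
Qed.

(** * Fusion and decision of stems *)

Context (hs : semiselective H).

(** Stage [n] treats the finitely many stems supported in [0, n]. The clause on [D] says that
    everything in [H] below [B] is compatible with [C], which transfers negative requirements from
    [C] to [B]. *)
Lemma fusion (T : countType) (P : T -> seq (FIN k) -> blockseq k -> Prop) A :
    H A ->
    (forall t b C D, P t b C -> H D -> block_le D C -> P t b D) ->
    (forall t b C, fin_block b -> H C -> block_le C A ->
      exists D, [/\ H D, block_le D C & P t b D]) ->
  exists B, [/\ H B, block_le B A &
    forall t b, fin_block b -> in_span b B -> choice.pickle t <= size b ->
    exists C, [/\ P t b C, cyl b B `<=` cyl b C &
      forall D, H D -> block_le D B ->
        exists D', [/\ H D', block_le D' D & block_le D' C]]].
Proof.
move=> HA Po Pd.
pose Q (x : T * seq (FIN k)) C := fin_block x.2 -> P x.1 x.2 C.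
have Qo x C D : Q x C -> H D -> block_le D C -> Q x D.
  by move=> QC HD DC /QC PC; apply: Po PC HD DC.
have Qd x C : H C -> block_le C A -> exists D, [/\ H D, block_le D C & Q x D].
  move=> HC CA; have [xb|nxb] := boolP (pairwise (@block_lt k) x.2); last first.
    by exists C; split=> //; [exact: block_le_refl|move=> xb; rewrite xb in nxb].
  by have [D [HD DC DP]] := Pd x.1 x.2 C xb HC CA; exists D; split.
have [L_ LP] := choice finite_fin_block.
pose Tl m : seq T := pmap choice.unpickle (iota 0 m.+1).
have mem_Tl t m : choice.pickle t <= m -> t \in Tl m.
  move=> tm; rewrite mem_pmap; apply/mapP; exists (choice.pickle t).
    by rewrite mem_iota add0n ltnS.
  by rewrite choice.pickleK.
(* The empty stem has no last term to index a stage, so it is handled in advance; only code 0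
   concerns it. *)
have [A1 [HA1 A1A A1P]] :=
  dense_seq [seq (t, [::] : seq (FIN k)) | t <- Tl 0] Qo Qd HA (@block_le_refl A).
(* A stem whose last term has maximum [n] has length at most [n + 1], hence the codes up to
   [n + 1]. *)
pose L n := [seq (t, b) | t <- Tl n.+1, b <- L_ n].
(* Semiselectivity asks for density in all of H, so D_ n must also admit the
   sequences incompatible with A. *)
pose compat C := exists E, [/\ H E, block_le E C & block_le E A].
pose D_ n := [set C | H C /\ (compat C -> forall x, x \in L n -> Q x C)].
have D_d n : dense_open H (D_ n).
  split=> [C []//|C D [HD QD] HC CD|C HC].
    split=> // -[E [HE EC EA]] x xL; apply: (Qo x D C _ HC CD); apply: QD xL.
    by exists E; split=> //; apply: block_le_trans CD.
  have [[E [HE EC EA]]|nC] := pselect (compat C); last first.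
    by exists C; [split|exact: block_le_refl].
  have [D [HD DE DQ]] := dense_seq (L n) Qo Qd HE EA.
  by exists D; [split|exact: block_le_trans EC].
have [A_ [_ A_D [B [HB BA1] Bd]]] := hs HA1 D_d.
have BA := block_le_trans BA1 A1A.
exists B; split=> // t b; case/lastP: b => [|b p] bb bB tb.
  exists B; split=> // [|D HD DB]; last first.
    by exists D; split=> //; exact: block_le_refl.
  apply: Po (A1P (t, [::]) _ _) HB BA1 => //.
  by apply/mapP; exists t => //; apply: mem_Tl.
have bp q : q \in rcons b p -> max_supp q <= max_supp p.
  rewrite mem_rcons inE => /predU1P[->//|qb].
  move: bb; rewrite /fin_block pairwise_rcons => /andP[/allP/(_ q qb)].
  by move=> /block_lt_max/ltnW.
have Bp : span (terms B) p by apply: bB; rewrite mem_rcons mem_head.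
(* The condition for this stem is the tail of [B] beyond its last term [p]; diagonalization puts it
   below [A_ (max_supp p)]. *)
have [C [HC CE CB]] := coideal_tail p HB.
have CA_ : block_le C (A_ (max_supp p)).
  by rewrite /block_le CE; apply: Bd.
have [HA_ A_P] := A_D (max_supp p).
exists C; split.
- suff QA : Q (t, rcons b p) (A_ (max_supp p)) by apply: Po (QA bb) HC CA_.
  apply: A_P; first by exists C; split=> //; exact: block_le_trans BA.
  apply/allpairsP; exists (t, rcons b p); split=> //=; last exact: LP.
  apply: mem_Tl; apply: leq_trans tb _.
  by rewrite size_rcons ltnS; exact: size_fin_block.
- move=> X [Xb XB]; split=> // i bi; rewrite CE; apply: span_tail => //.
    exact: XB.
  have -> : p = term X (size b).
    by move: Xb; rewrite size_rcons mkseqS => /rcons_inj[].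
  by apply: term_lt; move: bi; rewrite size_rcons.
- move=> D HD DB; have [D' [HD' D'E D'D]] := coideal_tail p HD.
  exists D'; split=> // _ [i _ <-]; rewrite CE.
  have [_ /(_ p)] : tail D [:: p] (term D' i) by rewrite -D'E; exists i.
  rewrite mem_head => /(_ isT) pD'; apply: span_tail => //.
  exact: block_le_span DB (D'D _ (ex_intro2 _ _ i I erefl)).
Qed.

(** Both alternatives persist downwards, and some [D] below any condition satisfies one of them. The
    compatibility clause of [fusion] carries the negative one over to [B]. *)
Lemma decide (T : countType) (Z : T -> set (blockseq k)) A : H A ->
  exists B, [/\ H B, block_le B A &
    forall t b, fin_block b -> in_span b B -> choice.pickle t <= size b ->
    cyl b B `<=` Z t \/ forall D, H D -> block_le D B -> ~ cyl b D `<=` Z t].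
Proof.
move=> HA.
pose P t b C :=
  cyl b C `<=` Z t \/ forall D, H D -> block_le D C -> ~ cyl b D `<=` Z t.
have [|t b C _ HC CA|B [HB BA BP]] := @fusion T P A HA.
- move=> t b C D [CZ|nZ] HD DC; first by left=> X /(cylS DC)/CZ.
  by right=> E HE ED; apply: nZ HE (block_le_trans ED DC).
- have [[D [HD DC DZ]]|nZ] :=
      pselect (exists D, [/\ H D, block_le D C & cyl b D `<=` Z t]).
    by exists D; split=> //; left.
  exists C; split=> //; first exact: block_le_refl.
  by right=> D HD DC DZ; apply: nZ; exists D.
exists B; split=> // t b bb bB tb; have [C [PC BC Cd]] := BP t b bb bB tb.
case: PC => [CZ|nZ]; [by left=> X /BC/CZ|right=> D HD DB DZ].
have [D' [HD' D'D D'C]] := Cd D HD DB.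
by apply: (nZ D' HD' D'C) => X /(cylS D'D)/DZ.
Qed.

Lemma uniform (T : countType)
    (R : T -> seq (FIN k) -> set (blockseq k) -> Prop) A : H A ->
    (forall t b (V V' : set (blockseq k)), V `<=` V' -> R t b V' -> R t b V) ->
    (forall t b C, fin_block b -> H C -> block_le C A ->
      exists D, [/\ H D, block_le D C & R t b (cyl b D)]) ->
  exists B, [/\ H B, block_le B A &
    forall t b, fin_block b -> in_span b B -> choice.pickle t <= size b ->
    R t b (cyl b B)].
Proof.
move=> HA RS Rd.
have [||B [HB BA BP]] := @fusion T (fun t b C => R t b (cyl b C)) A HA.
- by move=> t b C D RC HD DC; apply: RS RC; exact: cylS.
- exact: Rd.
exists B; split=> // t b bb bB tb; have [C [RC BC _]] := BP t b bb bB tb.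
exact: RS RC.
Qed.

(** * Open sets and countable intersections of open sets *)

Context (hg : gowers H).

Lemma gowers_set A (O : set (FIN k)) : H A -> exists B, [/\ H B, block_le B A &
  span (terms B) `<=` O \/ span (terms B) `<=` ~` O].
Proof.
move=> HA; pose f p : 'I_2 := if `[<O p>] then ord0 else ord_max.
have [B [HB BA] [c Bc]] := hg (ltn0Sn 1) f HA.
exists B; split=> //; have [c0|c1] := eqVneq c ord0; [left|right] => p /Bc.
  by rewrite /f c0; case: asboolP.
by rewrite /f => fc Op; move: c1; rewrite -fc; case: asboolP.
Qed.

(** If the empty stem is rejected, fusion makes every one-step extension of a rejected stem
    rejected. Then all initial segments of any [X] below [B] are rejected, whereas openness would
    give an [X] in [U] one whose cylinder lies in [U]. *)
Lemma open_ramsey A (U : set (blockseq k)) : mopen U -> H A ->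
  exists B, [/\ H B, block_le B A &
    (forall X, block_le X B -> U X) \/ (forall X, block_le X B -> ~ U X)].
Proof.
move=> oU HA; have [B1 [HB1 B1A B1d]] := @decide nat (fun=> U) A HA.
pose rej b := forall D, H D -> block_le D B1 -> ~ cyl b D `<=` U.
have {}B1d b : fin_block b -> in_span b B1 -> cyl b B1 `<=` U \/ rej b.
  by move=> bb bB1; apply: (B1d 0).
have [//|//|B1U|rej0] := B1d [::].
  by exists B1; split=> //; left=> X XB1; apply/B1U/cyl_nil.
(* The index is a dummy: [choice.pickle 0 <= size b] always holds. *)
pose P (t : nat) b C := in_span b B1 -> rej b ->
  forall p, span (terms C) p -> fin_block (rcons b p) -> rej (rcons b p).
have [||B [HB BB1 BP]] := @fusion nat P B1 HB1.
- by move=> t b C D PC HD DC bB1 bj p /(block_le_span DC); exact: PC.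
- move=> t b C bb HC CB1.
  (* Color [p] by whether appending it to [b] forces membership in [U]. If all colors were positive,
     every [X] in [cyl b D] would be in [U] through its next term, against the rejection of [b]. *)
  have [D [HD DC DO]] := gowers_set [set p | cyl (rcons b p) B1 `<=` U] HC.
  have DB1 := block_le_trans DC CB1.
  exists D; split=> // bB1 bj p Dp bp; case: DO => [DU|/(_ p Dp) DU].
    case: (bj D HD DB1) => X DX; have [Xb XD] := DX.
    have [XX _] := cyl_mkseq DX (leqnSn (size b)).
    rewrite mkseqS Xb in XX.
    by apply: (DU (term X (size b))) (cylS DB1 XX); apply: XD.
  have [//|q|/DU//|//] := B1d (rcons b p).
  rewrite mem_rcons inE => /predU1P[->|/bB1//].
  exact: block_le_span DB1 Dp.
exists B; split; [by []|exact: block_le_trans B1A|right=> X XB UX].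
have XB1 := block_le_trans XB BB1.
have Xrej n : rej (mkseq (term X) n).
  elim: n => // n IH.
  have [//||//|C [PC BC _]] := BP 0 (mkseq (term X) n).
  - exact: fin_block_mkseq.
  - exact: in_span_mkseq.
  rewrite mkseqS; apply: PC IH _ _ _; first exact: in_span_mkseq.
    by have [_] := BC X (cyl_mkseq0 n XB); apply; rewrite size_mkseq.
  by rewrite -mkseqS; exact: fin_block_mkseq.
have [n XU] := oU X UX.
by apply: (Xrej n B1 HB1 (@block_le_refl B1)) => Y /mkseq_cyl; exact: XU.
Qed.

Lemma open_ramsey_stem A b (U : set (blockseq k)) : fin_block b -> mopen U -> H A ->
  exists B, [/\ H B, block_le B A &
    cyl b B `<=` U \/ forall X, cyl b B X -> ~ U X].
Proof.
move=> bb oU HA; have [B [HB BA BU]] := open_ramsey (mopen_fiber bb oU) HA.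
exists B; split=> //; case: BU => BU; [left; exact: fiber_sub|right].
exact: fiber_disj.
Qed.

Lemma gdelta_ramsey A (U : nat -> set (blockseq k)) :
    (forall i, mopen (U i)) -> H A ->
  exists B, [/\ H B, block_le B A &
    (forall X, block_le X B -> forall i, U i X) \/
    (forall X, block_le X B -> ~ forall i, U i X)].
Proof.
move=> oU HA.
have [||D [HD DA DU]] := @uniform nat (fun i _ V =>
  V `<=` U i \/ forall X, V X -> ~ U i X) A HA.
- by move=> i _ V V' VV' [VU|VU]; [left=> X /VV'/VU|right=> X /VV'/VU].
- by move=> i b C bb HC _; exact: open_ramsey_stem.
(* The code of a natural number is the number itself, so the stem of length [i] is already decided
   for [U i]. Outside [W] every such decision is positive. *)
pose W := [set X | exists i, forall Y, cyl (mkseq (term X) i) D Y -> ~ U i Y].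
have oW : mopen W.
  by move=> X [i WX]; exists i => Y YX; exists i; rewrite YX.
have [B [HB BD BW]] := open_ramsey oW HD.
exists B; split; [by []|exact: block_le_trans DA|].
case: BW => BW; [right|left] => X XB; have XD := block_le_trans XB BD.
  by have [i XU] := BW X XB; move/(_ i); apply/XU/cyl_mkseq0.
move=> i; have [||//|XU|XU] := DU i (mkseq (term X) i).
- exact: fin_block_mkseq.
- exact: in_span_mkseq.
- by rewrite size_mkseq.
- exact/XU/cyl_mkseq0.
- by case: (BW X XB); exists i.
Qed.

Lemma gdelta_ramsey_stem A b (U : nat -> set (blockseq k)) :
    fin_block b -> (forall i, mopen (U i)) -> H A ->
  exists B, [/\ H B, block_le B A &
    cyl b B `<=` [set X | forall i, U i X] \/
    forall X, cyl b B X -> ~ forall i, U i X].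
Proof.
move=> bb oU HA.
have [B [HB BA BU]] := gdelta_ramsey (fun i => mopen_fiber bb (oU i)) HA.
exists B; split=> //; case: BU => BU; [left|right].
  by apply: fiber_sub => Y /BU YU X YX i; apply: YU.
apply: (@fiber_disj b B [set X | forall i, U i X]) => Y /BU nY YU; apply: nY.
by move=> i X YX; apply: YU.
Qed.

(** * Souslin schemes and analytic sets *)

Lemma souslin_ramsey A (X : seq nat -> set (blockseq k)) :
    (forall s, X s `<=` \bigcup_i X (rcons s i)) ->
    (forall (g : nat -> nat) Y,
      (forall n m, exists2 Z, X (mkseq g n) Z & mkseq (term Z) m = mkseq (term Y) m) ->
      X [::] Y) ->
    H A ->
  exists B, [/\ H B, block_le B A &
    (forall Y, block_le Y B -> X [::] Y) \/ (forall Y, block_le Y B -> ~ X [::] Y)].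
Proof.
move=> XS Xlim HA.
have [B0 [HB0 B0A B0d]] := @decide (seq nat) (fun s => ~` X s) A HA.
(* Stems shorter than the code of [s] are excluded because [B0] decides [X s] only from that length
   on. *)
pose K s := [set Y | exists2 n, choice.pickle s <= n &
  cyl (mkseq (term Y) n) B0 `<=` ~` X s].
have oK s : mopen (K s).
  by move=> Y [n sn YX]; exists n => Z ZY; exists n; rewrite ?ZY.
have KX s Y : block_le Y B0 -> K s Y -> ~ X s Y.
  by move=> YB0 [n _]; apply; apply: cyl_mkseq0.
pose M s := [set Y | [/\ block_le Y B0, ~ K s Y & forall i, K (rcons s i) Y]].
have [||B [HB BB0 BM]] := @uniform (seq nat) (fun s _ V =>
  forall Y, V Y -> ~ M s Y) B0 HB0.
- by move=> s _ V V' VV' VM Y /VV'/VM.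
- move=> s b C bb HC CB0.
  have [D [HD DC DK]] := gdelta_ramsey_stem bb (fun i => oK (rcons s i)) HC.
  have DB0 := block_le_trans DC CB0.
  exists D; split=> // Y DY [YB0 nK YK]; case: DK => [DK|/(_ Y DY)//].
  (* Long enough to extend [b] and for the decision on [s] to apply. *)
  pose n := maxn (size b) (choice.pickle s).
  have [_ DYD] := cyl_mkseq DY (leq_maxl (size b) (choice.pickle s)).
  have [|||YX|nYX] := B0d s (mkseq (term Y) n).
  + exact: fin_block_mkseq.
  + exact: in_span_mkseq.
  + by rewrite size_mkseq leq_maxr.
  + by apply: nK; exists n; rewrite ?leq_maxr.
  (* A point of [X s] lies in some [X (rcons s i)], but points of [K (rcons s i)] below [B0] avoid
     that set. So the cylinder misses [X s], against the decision. *)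
  + apply: (nYX D HD DB0) => Z DZ XZ; have [i _ XiZ] := XS s Z XZ.
    apply: (KX (rcons s i) Z) XiZ; last exact: DK (DYD _ DZ) i.
    exact: cyl_le YB0 DB0 DZ.
have {}BM Y s : block_le Y B -> ~ K s Y -> exists i, ~ K (rcons s i) Y.
  move=> YB nK; apply: contrapT => nE.
  apply: (BM s (mkseq (term Y) (choice.pickle s)) _ _ _ Y).
  - exact: fin_block_mkseq.
  - exact: in_span_mkseq.
  - by rewrite size_mkseq.
  - exact: cyl_mkseq0.
  - split=> // [|i]; first exact: block_le_trans BB0.
    by apply: contrapT => nKi; apply: nE; exists i.
have [E [HE EB EK]] := open_ramsey (oK [::]) HB.
exists E; split; [by []|exact: block_le_trans (block_le_trans BB0 B0A)|].
case: EK => EK; [right|left] => Y YE.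
  exact: KX (block_le_trans YE (block_le_trans EB BB0)) (EK Y YE).
have YB := block_le_trans YE EB; have YB0 := block_le_trans YB BB0.
have /choice[next nextP] : forall s, exists i, ~ K s Y -> ~ K (rcons s i) Y.
  move=> s; have [Ks|/(BM _ _ YB)[i Ki]] := pselect (K s Y); first by exists 0.
  by exists i.
pose st n := iter n (fun s => rcons s (next s)) [::].
have stE n : st n = mkseq (next \o st) n by elim: n => // n IH; rewrite mkseqS -IH.
have nKst n : ~ K (st n) Y.
  by elim: n => [|n IH]; [exact: EK YE|exact: nextP].
apply: (Xlim (next \o st)) => n m; rewrite -stE.
(* Were no point of [X (st n)] to agree with [Y] on [m] terms, the stem of length [N] would put [Y]
   in [K (st n)]. *)
pose N := maxn m (choice.pickle (st n)); apply: contrapT => nZ.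
apply: (nKst n); exists N; first exact: leq_maxr.
move=> Z /mkseq_cyl ZY XZ; apply: nZ; exists Z => //.
by apply: mkseq_le ZY; exact: leq_maxl.
Qed.

(** Shrinking [A] to a tail beyond [b] lets [b] be put before the homogeneous [B]. The witness [C]
    is this concatenation: it is in [H] because [B] is below it, and by [cyl_cat_sub] members of
    [b, C] still have their tails below [B]. *)
Lemma ramsey_stem A b (U : set (blockseq k)) : fin_block b ->
    (forall A', H A' -> exists B, [/\ H B, block_le B A' &
      (forall Y X, block_le Y B -> is_cat b Y X -> U X) \/
      (forall Y X, block_le Y B -> is_cat b Y X -> ~ U X)]) ->
  H A -> exists B, [/\ ellentuck b A B, H B &
    ellentuck b B `<=` U \/ ellentuck b B `&` U = set0].
Proof.
move=> bb UR HA.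
have [A' [HA' A'A bA']] : exists A', [/\ H A', block_le A' A &
    forall p q, p \in b -> terms A' q -> block_lt p q].
  case/lastP: b bb {UR} => [|b p] bp.
    by exists A; split=> //; exact: block_le_refl.
  have [A' [HA' A'E A'A]] := coideal_tail p HA.
  exists A'; split=> // q r; rewrite A'E mem_rcons inE => qb [_ /(_ p)].
  rewrite mem_head => /(_ isT) pr; move: qb => /predU1P[->//|qb].
  move: bp; rewrite /fin_block pairwise_rcons => /andP[/allP/(_ q qb) qp _].
  exact: block_lt_trans pr.
have [B [HB BA' BU]] := UR A' HA'.
have [p pb|C BC] := @is_cat_exists b B bb.
  apply: (@span_block_lt (terms A')); first by move=> q; exact: bA'.
  by apply: BA'; exists 0.
have BA := block_le_trans BA' A'A.
exists C; split.
- split; first by exists (size b); rewrite BC.1.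
  move=> _ [[i _ <-] bC]; have [bi|ib] := leqP (size b) i.
    by rewrite -(subnKC bi) BC.2; apply: BA; exists (i - size b).
  by have := bC _ (is_cat_mem BC ib); rewrite block_ltxx.
- apply: (coideal_le _ HB) => _ [i _ <-].
  by rewrite -BC.2; exact: term_span.
- have Xcat X : ellentuck b C X -> exists2 Y, is_cat b Y X & block_le Y B.
    by move=> /ellentuck_cyl/(cyl_cat_sub BC)/cyl_is_cat.
  case: BU => BU; [left=> X /Xcat[Y YX YB]|right]; first exact: BU YB YX.
  by rewrite -subset0 => X [/Xcat[Y YX YB]]; exact: BU YB YX.
Qed.

Lemma analytic_ramsey (U : set (blockseq k)) : analytic U -> ramsey H U.
Proof.
move=> [->|[f [cf <-]]] A b HA bb; apply: ramsey_stem => // A' HA'.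
  by exists A'; split; [|exact: block_le_refl|right=> Y X _ _ []].
(* The tails that [b] completes to a point of the image of the basic open set given by [s]. *)
pose X s := [set Y | exists2 h : baire_space,
  mkseq h (size s) = s & is_cat b Y (f h)].
have [|||B [HB BA' BX]] := @souslin_ramsey A' X.
- move=> s Y [h sh hY]; exists (h (size s)) => //; exists h => //.
  by rewrite size_rcons mkseqS sh.
(* The branch [g] itself is the witness: the points [h] agree with [g] as far as continuity at [g]
   requires, so [f g] has the initial segments of [b] followed by [Y]. *)
- move=> g Y gY; exists (g : baire_space) => //; apply: mkseq_is_cat => m.
  have [n fn] := continuous_baire g (size b + m) cf.
  have [Z [h gh hZ] ZY] := gY n m.
  rewrite -(fn h) ?(is_cat_mkseq _ hZ) ?ZY // => i i_n.
  have := congr1 (fun s => nth 0 s i) gh.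
  by rewrite /= size_mkseq !nth_mkseq.
- exact: HA'.
exists B; split=> //; case: BX => BX; [left|right] => Y Z YB YZ.
  have [h _ Yh] := BX Y YB; exists h => //.
  by rewrite (is_cat_inj YZ Yh).
by move=> [h _ hZ]; apply: (BX Y YB); exists h; rewrite ?hZ.
Qed.

End Coideal.
End Blocks.

Theorem corollary5 (k : nat) (hk : (1 <= k)%N) (H : set (blockseq k))
    (hcoideal : coideal H) (hgowers : gowers H) (hsemi : semiselective H)
    (X : set (blockseq k)) (hX : analytic X) :
  ramsey H X.
Proof. exact: analytic_ramsey. Qed.
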